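(* Consider the system $$x_{n+1}=\frac{b_1x_n}{1+x_n+c_1y_n},\qquad y_{n+1}=\frac{b_2y_n}{1+y_n+c_2x_n},\qquad n=0,1,\ldots,$$ where all parameters $b_1,b_2,c_1,c_2$ are positive and the initial conditions $x_0,y_0$ are non-negative. Assume that $$c_1(b_2-1)=b_1-1\quad\text{and}\quad c_2(b_1-1)=b_2-1.$$ Let $\mathcal{E}:=\{((b_1-1)(1-t),(b_2-1)t):0\le t\le 1\}$. Then: (i) Every nonzero solution of the system converges to an equilibrium $(\overline{x},\overline{y})\in\mathcal{E}$. (ii) For every $(\overline{x},\overline{y})\in\mathcal{E}$ with $\overline{x}\ne 0$ and $\overline{y}\ne 0$, the stable set $\mathcal{W}^s_{(\overline{x},\overline{y})}$ is an unbounded increasing curve $\mathcal{C}$ with endpoint $(0,0)$. (iii) The limiting equilibrium varies continuously with the initial condition.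
   Context: Let $T(x,y)=\left(\frac{b_1x}{1+x+c_1y},\frac{b_2y}{1+y+c_2x}\right)$ on $[0,\infty)^2$ be the map of the system; an equilibrium is a fixed point of $T$. The stable set $\mathcal{W}^s_{(\overline{x},\overline{y})}$ is the set of $\mathrm{x}\in[0,\infty)^2$ with $T^n(\mathrm{x})\to(\overline{x},\overline{y})$. An increasing curve is the graph of a strictly increasing continuous function of the first coordinate on an interval. Statement (iii) means that, with $T^*(x,y):=\lim_{n\to\infty}T^n(x,y)$, the function $T^*$ is continuous.
   Formalization: The formal theorem assumes b_1 ≥ 1 (hence b_2 ≥ 1), since for b_1 < 1 all solutions tend to (0,0), which is not in E; and (iii) asserts continuity of T* on [0,∞)^2 without the origin, where T* is discontinuous if b_1 > 1. *)

(* Defs.v *)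
From HB Require Import structures.
From mathcomp Require Import all_boot all_order all_algebra.
From mathcomp Require Import all_classical all_reals all_analysis.
Set Implicit Arguments.
Unset Strict Implicit.
Unset Printing Implicit Defensive.
Import Order.TTheory GRing.Theory Num.Theory.
Import numFieldNormedType.Exports.
Local Open Scope classical_set_scope.
Local Open Scope ring_scope.

Definition quadrant (R : realType) : set (R * R) :=
  [set z | 0 <= z.1 /\ 0 <= z.2].
Arguments quadrant : clear implicits.

(* Defined on the whole plane so that it can be iterated freely; only its
   values on [quadrant R], which it preserves for positive parameters, matter. *)
Definition lgmap (R : realType) (b1 b2 c1 c2 : R) (z : R * R) : R * R :=
  (b1 * z.1 / (1 + z.1 + c1 * z.2), b2 * z.2 / (1 + z.2 + c2 * z.1)).

Definition solution (R : realType) (T : R * R -> R * R) (u : nat -> R * R) :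
    Prop :=
  quadrant R (u 0%N) /\ forall n, u n.+1 = T (u n).

Definition equilibrium (R : realType) (T : R * R -> R * R) (e : R * R) : Prop :=
  quadrant R e /\ T e = e.

Definition stable_set (R : realType) (T : R * R -> R * R) (e : R * R) :
    set (R * R) :=
  [set z | quadrant R z /\ iter n T z @[n --> \oo] --> e].

(* The limit of the orbit of [z]; the value [(0, 0)] is a default, used only
   where the orbit diverges (the library's [lim] has no instance on [R * R]). *)
Definition limit_map (R : realType) (T : R * R -> R * R) (z : R * R) : R * R :=
  xget (0, 0) [set e : R * R | iter n T z @[n --> \oo] --> e].

(* Consists of points of the quadrant iff [1 <= b1] and [1 <= b2]; when
   [c1 * (b2 - 1) = b1 - 1] with [0 < c1], these two conditions are equivalent. *)
Definition segmentE (R : realType) (b1 b2 : R) : set (R * R) :=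
  [set z | exists t : R, 0 <= t <= 1 /\
                         z = ((b1 - 1) * (1 - t), (b2 - 1) * t)].

Definition increasing_graph (R : realType) (I : set R) (f : R -> R)
    (C : set (R * R)) : Prop :=
  [/\ is_interval I,
      {in I &, {homo f : x y / x < y}},
      {within I, continuous f}
    & C = [set z | I z.1 /\ z.2 = f z.1]].

(* [p] is the lower-left end of the graph of [f] over [I]; it need not belong
   to the graph, since [I] may be open at [p.1]. *)
Definition lower_endpoint (R : realType) (I : set R) (f : R -> R) (p : R * R) :
    Prop :=
  [/\ closure I p.1, lbound I p.1
    & f x @[x --> within I (nbhs p.1)] --> p.2].

Definition unbounded_increasing_curve_from (R : realType) (p : R * R)
    (C : set (R * R)) : Prop :=
  exists (I : set R) (f : R -> R),
    [/\ increasing_graph I f C, lower_endpoint I f p & ~ bounded_set C].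

(* Main.v *)
Require Import Defs.
From HB Require Import structures.
From mathcomp Require Import all_boot all_order all_algebra.
From mathcomp Require Import all_classical all_reals all_analysis.
From mathcomp Require Import ring lra.
Set Implicit Arguments.
Unset Strict Implicit.
Unset Printing Implicit Defensive.
Import Order.TTheory GRing.Theory Num.Theory.
Import numFieldNormedType.Exports.
Local Open Scope classical_set_scope.
Local Open Scope ring_scope.

(* Put a = b1 - 1 and d = b2 - 1.  If a = 0, then d = 0, both coordinates
   decrease along orbits and everything converges to the origin.  Otherwise
   c1 = a / d and c2 = d / a, and with the level s = x / a + y / d the map is
   (x, y) |-> (g a s * x, g d s * y), where g a s = (1 + a) / (1 + a * s).  Hence
   both coordinates increase along an orbit while s <= 1 and decrease while
   s >= 1, neither region can be left, and the limit has level 1, that is, lies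
   on the segment of equilibria.

   The map preserves the south-east order (x <= x', y' <= y), so the limit map
   does.  It is continuous because an orbit close to its limit is squeezed
   between two neighbouring equilibria of the segment.

   The limit map is injective on south-east ordered pairs p <= q with a common
   interior limit: the sign of s(T^n p) - s(T^n q) is eventually constant, so
   the ratio of the second coordinates of T^n p and T^n q (or that of the first
   coordinates of T^n q and T^n p) moves monotonically away from 1 and cannot
   tend to 1.  Hence the fibre over an interior equilibrium is the graph of a
   strictly increasing relation, which by the intermediate value theorem meets
   every vertical and every horizontal line of the open quadrant; it is
   therefore a continuous curve from the origin to infinity. *)

(** * Convergence and order in the plane *)

Section Planar.
Context {R : realType}.
Implicit Types (u v : nat -> R * R) (e p q z : R * R).

Lemma continuous_fst z : fst @ z --> z.1.
Proof. by case: z => x y; exact: cvg_fst. Qed.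

Lemma continuous_snd z : snd @ z --> z.2.
Proof. by case: z => x y; exact: cvg_snd. Qed.

Lemma cvg_pair_fst (S : Type) (F : set_system S) {FF : Filter F}
    (f : S -> R * R) e : f @ F --> e -> (f x).1 @[x --> F] --> e.1.
Proof. by move=> h; exact: cvg_comp h (continuous_fst (z := e)). Qed.

Lemma cvg_pair_snd (S : Type) (F : set_system S) {FF : Filter F}
    (f : S -> R * R) e : f @ F --> e -> (f x).2 @[x --> F] --> e.2.
Proof. by move=> h; exact: cvg_comp h (continuous_snd (z := e)). Qed.

Lemma cvg_pairP (S : Type) (F : set_system S) {FF : Filter F}
    (f : S -> R * R) e :
  (f x).1 @[x --> F] --> e.1 -> (f x).2 @[x --> F] --> e.2 -> f @ F --> e.
Proof.
case: e => e1 e2 /= h1 h2.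
have -> : f = (fun x => ((f x).1, (f x).2)) by apply/funext => x; case: (f x).
exact: cvg_pair h1 h2.
Qed.

Lemma cvgn_pair_unique u e e' : u @ \oo --> e -> u @ \oo --> e' -> e = e'.
Proof. exact: (cvg_unique (@norm_hausdorff R (R * R)%type)). Qed.

(** The comparison with the first term later keeps the limit of an orbit away from the origin. *)
Lemma nondecreasing_pair_cvg u M1 M2 :
  (forall n, (u n).1 <= (u n.+1).1 /\ (u n).2 <= (u n.+1).2) ->
  (forall n, (u n).1 <= M1 /\ (u n).2 <= M2) ->
  exists2 e, u @ \oo --> e & (u 0%N).1 <= e.1 /\ (u 0%N).2 <= e.2.
Proof.
move=> incu ubu.
have i1 : {homo (fun n => (u n).1) : n m / (n <= m)%N >-> n <= m}.
  by apply/nondecreasing_seqP => n; have [] := incu n.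
have i2 : {homo (fun n => (u n).2) : n m / (n <= m)%N >-> n <= m}.
  by apply/nondecreasing_seqP => n; have [] := incu n.
have k1 : cvgn (fun n => (u n).1).
  apply: (nondecreasing_is_cvgn i1).
  by exists M1 => _ [n _ <-]; have [] := ubu n.
have k2 : cvgn (fun n => (u n).2).
  apply: (nondecreasing_is_cvgn i2).
  by exists M2 => _ [n _ <-]; have [] := ubu n.
exists (limn (fun n => (u n).1), limn (fun n => (u n).2)).
  exact: cvg_pairP.
by split; [exact: (nondecreasing_cvgn_le i1 k1 0%N) |
           exact: (nondecreasing_cvgn_le i2 k2 0%N)].
Qed.

Lemma nonincreasing_pair_cvg u M1 M2 :
  (forall n, (u n.+1).1 <= (u n).1 /\ (u n.+1).2 <= (u n).2) ->
  (forall n, M1 <= (u n).1 /\ M2 <= (u n).2) ->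
  exists e, u @ \oo --> e.
Proof.
move=> decu lbu.
have [||e he _] := @nondecreasing_pair_cvg (fun n => - u n) (- M1) (- M2).
- by move=> n; have [] := decu n; rewrite /= !lerN2.
- by move=> n; have [] := lbu n; rewrite /= !lerN2.
by exists (- e); rewrite -(opprK u); exact: cvgN.
Qed.

(* The south-east order, preserved by competitive maps. *)
Definition se_le p q := p.1 <= q.1 /\ q.2 <= p.2.

Lemma cvg_se_le u v e e' : u @ \oo --> e -> v @ \oo --> e' ->
  (forall n, se_le (u n) (v n)) -> se_le e e'.
Proof.
move=> hu hv huv; split.
  apply: (ler_cvg_to (cvg_pair_fst hu) (cvg_pair_fst hv)).
  by apply: nearW => n; have [] := huv n.
apply: (ler_cvg_to (cvg_pair_snd hv) (cvg_pair_snd hu)).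
by apply: nearW => n; have [] := huv n.
Qed.

End Planar.

(** * The competitive map: symmetry, continuity, south-east order *)

Section LeslieGower.
Context {R : realType} {b1 b2 c1 c2 : R}.
Context (hb1 : 0 < b1) (hb2 : 0 < b2) (hc1 : 0 < c1) (hc2 : 0 < c2).
Implicit Types (e p q z : R * R) (n : nat).
Local Notation T := (lgmap b1 b2 c1 c2).

(** Exchanging coordinates conjugates the map to one of the same family, so a fact about first
    coordinates transfers to second ones. *)
Lemma lgmap_swap z :
  lgmap b2 b1 c2 c1 (z.2, z.1) = ((T z).2, (T z).1).
Proof. by []. Qed.

Lemma iter_lgmap_swap n z :
  iter n (lgmap b2 b1 c2 c1) (z.2, z.1) = ((iter n T z).2, (iter n T z).1).
Proof. by elim: n => //= n ->; rewrite lgmap_swap. Qed.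

Lemma denominator_gt0 (c x y : R) : 0 < c -> 0 <= x -> 0 <= y ->
  0 < 1 + x + c * y.
Proof. by move=> c0 x0 y0; rewrite -addrA ltr_pwDl// addr_ge0// mulr_ge0// ltW. Qed.

Lemma lgmap_quadrant z : quadrant R z -> quadrant R (T z).
Proof.
move=> [x0 y0]; split => /=.
  by apply: divr_ge0; [exact: mulr_ge0 (ltW hb1) x0|exact/ltW/denominator_gt0].
by apply: divr_ge0; [exact: mulr_ge0 (ltW hb2) y0|exact/ltW/denominator_gt0].
Qed.

Lemma iter_quadrant n z : quadrant R z -> quadrant R (iter n T z).
Proof. by move=> hz; elim: n => //= n; exact: lgmap_quadrant. Qed.

Lemma lgmap_continuous z : quadrant R z -> {for z, continuous T}.
Proof.
move=> [x0 y0]; apply: cvg_pairP => /=.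
  apply: cvgM.
    by apply: cvgM; [exact: cvg_cst|exact: continuous_fst].
  apply: cvgV; first by rewrite gt_eqF// denominator_gt0.
  apply: cvgD; first by apply: cvgD; [exact: cvg_cst|exact: continuous_fst].
  by apply: cvgM; [exact: cvg_cst|exact: continuous_snd].
apply: cvgM.
  by apply: cvgM; [exact: cvg_cst|exact: continuous_snd].
apply: cvgV; first by rewrite gt_eqF// denominator_gt0.
apply: cvgD; first by apply: cvgD; [exact: cvg_cst|exact: continuous_snd].
by apply: cvgM; [exact: cvg_cst|exact: continuous_fst].
Qed.

Lemma iter_continuous n z : quadrant R z -> iter n T x @[x --> z] --> iter n T z.
Proof.
move=> hz; elim: n => [|n IHn] /=; first exact: cvg_id.
by apply: continuous_cvg IHn; apply: lgmap_continuous; exact: iter_quadrant.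
Qed.

Lemma cvg_iter_quadrant z e :
  quadrant R z -> iter n T z @[n --> \oo] --> e -> quadrant R e.
Proof.
move=> hz he; split.
  apply: (cvgr_to_ge (cvg_pair_fst he)).
  by apply: nearW => n; have [] := iter_quadrant n hz.
apply: (cvgr_to_ge (cvg_pair_snd he)).
by apply: nearW => n; have [] := iter_quadrant n hz.
Qed.

Lemma cvg_iter_fixed z e :
  quadrant R z -> iter n T z @[n --> \oo] --> e -> T e = e.
Proof.
move=> hz he; apply: (@cvgn_pair_unique _ (fun n => iter n.+1 T z)).
  exact: (continuous_cvg _ (lgmap_continuous (cvg_iter_quadrant hz he)) he).
exact: cvg_comp (cvg_addnl 1) he.
Qed.

(** With denominators cleared, the term [x1 * x2] cancels and the first inequality reads
    [x1 + c1 * x1 * y2 <= x2 + c1 * x2 * y1], which holds term by term. *)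
Lemma lgmap_se p q : quadrant R p -> quadrant R q -> se_le p q ->
  se_le (T p) (T q).
Proof.
move: p q => [x1 y1] [x2 y2] [/= x10 y10] [/= x20 y20] [/= hx hy].
split => /=.
  rewrite ler_pdivrMr ?denominator_gt0// mulrAC ler_pdivlMr ?denominator_gt0//.
  rewrite -!mulrA ler_pM2l//.
  have : x1 * y2 <= x2 * y1 by exact: ler_pM.
  by rewrite -(ler_pM2l hc1); lra.
rewrite ler_pdivrMr ?denominator_gt0// mulrAC ler_pdivlMr ?denominator_gt0//.
rewrite -!mulrA ler_pM2l//.
have : y2 * x1 <= y1 * x2 by exact: ler_pM.
by rewrite -(ler_pM2l hc2); lra.
Qed.

Lemma iter_se n p q : quadrant R p -> quadrant R q -> se_le p q ->
  se_le (iter n T p) (iter n T q).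
Proof.
by move=> hp hq hpq; elim: n => //= n; apply: lgmap_se; exact: iter_quadrant.
Qed.

(** A strict inequality in one coordinate spreads to both through the cross term
    [x1 * y2 < x2 * y1]; the positivity of [p.1] and [q.2] makes this term strict. *)
Lemma lgmap_se_strict p q : quadrant R p -> quadrant R q ->
  0 < p.1 -> 0 < q.2 -> se_le p q -> p <> q ->
  (T p).1 < (T q).1 /\ (T q).2 < (T p).2.
Proof.
move: p q => [x1 y1] [x2 y2] [/= x10 y10] [/= x20 y20] /= hx1 hy2 [/= hx hy] ne.
have : (x1 < x2) || (y2 < y1).
  rewrite !lt_neqAle hx hy !andbT -negb_and; apply/andP => -[/eqP ? /eqP ?].
  by apply: ne; congr pair.
move=> neq; have hlt : x1 * y2 < x2 * y1.
  case/orP: neq => h; first by apply: (@lt_le_trans _ _ (x2 * y2)); nra.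
  by apply: (@lt_le_trans _ _ (x1 * y1)); nra.
split.
  rewrite ltr_pdivrMr ?denominator_gt0// mulrAC ltr_pdivlMr ?denominator_gt0//.
  rewrite -!mulrA ltr_pM2l//.
  by move: hlt; rewrite -(ltr_pM2l hc1); lra.
rewrite ltr_pdivrMr ?denominator_gt0// mulrAC ltr_pdivlMr ?denominator_gt0//.
rewrite -!mulrA ltr_pM2l//.
by move: hlt; rewrite -(ltr_pM2l hc2); lra.
Qed.

End LeslieGower.

(* The map of the theorem with [a = b1 - 1] and [d = b2 - 1] positive: the two
   hypotheses then force [c1 = a / d] and [c2 = d / a]. *)
Definition segment_map (R : realType) (a d : R) : R * R -> R * R :=
  lgmap (1 + a) (1 + d) (a / d) (d / a).

Definition level (R : realType) (a d : R) (z : R * R) : R := z.1 / a + z.2 / d.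

Definition growth (R : realType) (a s : R) : R := (1 + a) / (1 + a * s).

(** * Estimates for the growth factors *)

Section Growth.
Context {R : realType}.
Implicit Types a d s t : R.

Lemma growth_denominator_gt0 a s : 0 < a -> 0 <= s -> 0 < 1 + a * s.
Proof. by move=> a0 s0; rewrite ltr_pwDl// mulr_ge0// ltW. Qed.

Lemma growth_gt0 a s : 0 < a -> 0 <= s -> 0 < growth a s.
Proof. by move=> a0 s0; rewrite divr_gt0 ?growth_denominator_gt0// addr_gt0. Qed.

Lemma growth_ge1 a s : 0 < a -> 0 <= s <= 1 -> 1 <= growth a s.
Proof.
move=> a0 /andP[s0 s1]; rewrite ler_pdivlMr ?growth_denominator_gt0//; nra.
Qed.

Lemma growth_le1 a s : 0 < a -> 1 <= s -> growth a s <= 1.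
Proof.
move=> a0 s1; rewrite ler_pdivrMr ?growth_denominator_gt0//; nra.
Qed.

Lemma growth_eq1 a s : 0 < a -> 0 <= s -> growth a s = 1 -> s = 1.
Proof.
move=> a0 s0 /(congr1 ( *%R^~ (1 + a * s))).
rewrite divfK ?gt_eqF ?growth_denominator_gt0// mul1r => /addrI h.
by apply: (mulfI (lt0r_neq0 a0)); rewrite mulr1.
Qed.

(** As a function of [s], [growth a s * s] is the one-dimensional Beverton-Holt map: increasing with
    fixed point 1, so it never crosses 1. *)
Lemma growth_mul_le1 a s : 0 < a -> 0 <= s <= 1 -> growth a s * s <= 1.
Proof.
move=> a0 /andP[s0 s1].
rewrite mulrAC ler_pdivrMr ?growth_denominator_gt0//; nra.
Qed.

Lemma growth_mul_ge1 a s : 0 < a -> 1 <= s -> 1 <= growth a s * s.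
Proof.
move=> a0 s1; rewrite mulrAC ler_pdivlMr ?growth_denominator_gt0//; nra.
Qed.

(** After cross-multiplication the difference of the two sides is exactly [(a - d) * (1 - s)]. *)
Lemma growth_homo a d s : 0 < a -> 0 < d -> 0 <= s ->
  0 <= (a - d) * (1 - s) -> growth d s <= growth a s.
Proof.
move=> a0 d0 s0 h; rewrite ler_pdivrMr ?growth_denominator_gt0//.
rewrite mulrAC ler_pdivlMr ?growth_denominator_gt0//; nra.
Qed.

Lemma growth_antitone a s t : 0 < a -> 0 <= s -> s <= t ->
  growth a t <= growth a s.
Proof.
move=> a0 s0 st; rewrite ler_pM2l ?addr_gt0// lef_pV2 ?posrE.
- by rewrite lerD2l ler_pM2l.
- by rewrite growth_denominator_gt0// (le_trans s0).
- by rewrite growth_denominator_gt0.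
Qed.

Lemma growth_diff a s t : 0 < a -> 0 <= s -> 0 <= t ->
  growth a s - growth a t = growth a t * (a * (t - s) / (1 + a * s)).
Proof.
move=> a0 s0 t0; rewrite /growth; field.
by rewrite !gt_eqF ?growth_denominator_gt0.
Qed.

(* Through the intermediate point on the level of [(x', y')] with second
   coordinate [y]: sliding from it to [(x', y')] trades the smaller growth rate
   for the larger one; reaching it from [(x, y)] gains [growth a (x' + y')] per
   unit of level, which by [hloss] outweighs the drop of the growth rates. *)
Lemma growth_sum_le a d x y x' y' : 0 < a -> 0 < d ->
  0 <= x -> 0 <= y -> 0 <= y' -> x <= x' -> y' <= y -> x + y <= x' + y' ->
  growth d (x' + y') <= growth a (x' + y') ->
  growth a (x + y) * x + growth d (x + y) * y <=
  growth a (x' + y') * x' + growth d (x' + y') * y'.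
Proof.
move=> a0 d0 x0 y0 y'0 xx' y'y st.
set s := x + y; set t := x' + y' => hg.
have s0 : 0 <= s by rewrite addr_ge0.
have t0 : 0 <= t by exact: le_trans st.
have pa := growth_gt0 a0 t0; have pd := growth_gt0 d0 t0.
have das := growth_denominator_gt0 a0 s0.
have dds := growth_denominator_gt0 d0 s0.
apply: (@le_trans _ _ (growth a t * (x + (t - s)) + growth d t * y)); last first.
  have -> : x + (t - s) = x' - (y - y') by rewrite /s /t; ring.
  nra.
have -> : growth a s = growth a t + growth a t * (a * (t - s) / (1 + a * s)).
  by rewrite -growth_diff//; ring.
have -> : growth d s = growth d t + growth d t * (d * (t - s) / (1 + d * s)).
  by rewrite -growth_diff//; ring.
(* Since [a * s <= 1 + a * s], the summands are at most [x / s] and [y / s], which add up to 1;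
   [s = 0] is treated apart. *)
have hloss : a * x / (1 + a * s) + d * y / (1 + d * s) <= 1.
  case: (eqVneq s 0) => [s00|sn0].
    have -> : x = 0 by move: s00; rewrite /s; lra.
    have -> : y = 0 by move: s00; rewrite /s; lra.
    by rewrite !mulr0 !mul0r addr0 ler01.
  have sp : 0 < s by rewrite lt_neqAle eq_sym sn0.
  apply: (@le_trans _ _ (x / s + y / s)); last by rewrite -mulrDl divff.
  apply: lerD.
    by rewrite ler_pdivrMr// mulrAC ler_pdivlMr//; nra.
  by rewrite ler_pdivrMr// mulrAC ler_pdivlMr//; nra.
set u := a * x / _ in hloss; set v := d * y / _ in hloss.
have v0 : 0 <= v by rewrite divr_ge0 ?(ltW dds)// mulr_ge0// ltW.
rewrite [X in X <= _](_ : _ = growth a t * x + growth d t * y +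
  (t - s) * (growth a t * u + growth d t * v)); last first.
  by rewrite /u /v; ring.
have hgain : growth a t * u + growth d t * v <= growth a t by nra.
by have := ler_wpM2l (_ : 0 <= t - s) hgain; rewrite subr_ge0 => /(_ st); lra.
Qed.

End Growth.

Lemma segment_map_swap (R : realType) (a d : R) n z :
  iter n (segment_map d a) (z.2, z.1) =
  ((iter n (segment_map a d) z).2, (iter n (segment_map a d) z).1).
Proof. exact: iter_lgmap_swap. Qed.

Lemma level_swap (R : realType) (a d : R) z :
  level d a (z.2, z.1) = level a d z.
Proof. exact: addrC. Qed.

(** * The level along orbits and convergence to the segment *)

Section SegmentMap.
Context {R : realType} {a d : R} (a0 : 0 < a) (d0 : 0 < d).
Implicit Types (e p q z : R * R) (n : nat).
Local Notation T := (segment_map a d).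
Local Notation s := (level a d).
Let a1 : 0 < 1 + a. Proof. exact: addr_gt0. Qed.
Let d1 : 0 < 1 + d. Proof. exact: addr_gt0. Qed.
Let ad : 0 < a / d. Proof. exact: divr_gt0. Qed.
Let da : 0 < d / a. Proof. exact: divr_gt0. Qed.

Lemma segment_mapE z : T z = (growth a (s z) * z.1, growth d (s z) * z.2).
Proof.
rewrite /segment_map /lgmap /growth /level; congr pair.
  rewrite mulrAC; congr (_ / _ * _).
  by field; rewrite !gt_eqF.
rewrite mulrAC; congr (_ / _ * _).
by field; rewrite !gt_eqF.
Qed.

Lemma level_ge0 z : quadrant R z -> 0 <= s z.
Proof. by move=> [x0 y0]; rewrite addr_ge0// divr_ge0// ltW. Qed.

Lemma level_gt0 z : quadrant R z -> z <> (0, 0) -> 0 < s z.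
Proof.
move=> hz nz; rewrite lt_neqAle level_ge0// andbT eq_sym.
move: z hz nz => [x y] [/= x0 y0] nz; apply/eqP => /eqP.
rewrite /level/= paddr_eq0 ?divr_ge0 ?(ltW a0) ?(ltW d0)//.
rewrite !mulf_eq0 !invr_eq0 !(gt_eqF a0) !(gt_eqF d0) !orbF => /andP[/eqP ? /eqP ?].
by apply: nz; congr pair.
Qed.

Lemma quadrant_iter n z : quadrant R z -> quadrant R (iter n T z).
Proof. exact: iter_quadrant. Qed.

Lemma level_segment_map z :
  s (T z) = growth a (s z) * (z.1 / a) + growth d (s z) * (z.2 / d).
Proof. by rewrite {1}/level segment_mapE /= !mulrA. Qed.

Lemma level_segment_map_gt0 z : quadrant R z -> 0 < s z -> 0 < s (T z).
Proof.
move=> [x0 y0] h; rewrite level_segment_map.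
have ga := growth_gt0 a0 (ltW h); have gd := growth_gt0 d0 (ltW h).
have X0 : 0 <= z.1 / a by rewrite divr_ge0// ltW.
have Y0 : 0 <= z.2 / d by rewrite divr_ge0// ltW.
move: h; rewrite /level; move: (growth _ _) (growth _ _) ga gd => g1 g2 ga gd.
by case: (ltgtP (z.1 / a) 0) X0 => // [hx|->] _ h; nra.
Qed.

Lemma level_iter_gt0 n z : quadrant R z -> 0 < s z -> 0 < s (iter n T z).
Proof.
move=> hz h; elim: n => //= n; apply: level_segment_map_gt0.
exact: quadrant_iter.
Qed.

(** The new level is the average of [growth a (s z) * s z] and [growth d (s z) * s z] with weights
    [z.1 / a] and [z.2 / d], whose sum is [s z]. Multiplying by [s z] avoids dividing by it. *)
Lemma level_segment_map_le1 z : quadrant R z -> s z <= 1 -> s (T z) <= 1.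
Proof.
move=> hz h; have s0 := level_ge0 hz; rewrite level_segment_map.
have hga : growth a (s z) * s z <= 1 by apply: growth_mul_le1; rewrite ?s0.
have hgd : growth d (s z) * s z <= 1 by apply: growth_mul_le1; rewrite ?s0.
have [x0 y0] := hz.
have X0 : 0 <= z.1 / a by rewrite divr_ge0// ltW.
have Y0 : 0 <= z.2 / d by rewrite divr_ge0// ltW.
case: (ltgtP (s z) 0) s0 => // [sp|s00] _; last first.
  have [-> ->] : z.1 / a = 0 /\ z.2 / d = 0 by move: s00; rewrite /level; lra.
  by rewrite !mulr0 addr0.
rewrite -(ler_pM2l sp) mulr1 [X in _ <= X]/level.
rewrite [X in X <= _](_ : _ = growth a (s z) * s z * (z.1 / a) +
  growth d (s z) * s z * (z.2 / d)); last by ring.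
by apply: lerD; rewrite ler_piMl.
Qed.

Lemma level_segment_map_ge1 z : quadrant R z -> 1 <= s z -> 1 <= s (T z).
Proof.
move=> [x0 y0] h; rewrite level_segment_map.
have sp : 0 < s z by exact: lt_le_trans h.
have hga : 1 <= growth a (s z) * s z by exact: growth_mul_ge1.
have hgd : 1 <= growth d (s z) * s z by exact: growth_mul_ge1.
have X0 : 0 <= z.1 / a by rewrite divr_ge0// ltW.
have Y0 : 0 <= z.2 / d by rewrite divr_ge0// ltW.
rewrite -(ler_pM2l sp) mulr1 [X in X <= _]/level.
rewrite [X in _ <= X](_ : _ = growth a (s z) * s z * (z.1 / a) +
  growth d (s z) * s z * (z.2 / d)); last by ring.
by apply: lerD; rewrite ler_peMl.
Qed.

Lemma level_iter_le1 n z : quadrant R z -> s z <= 1 -> s (iter n T z) <= 1.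
Proof.
move=> hz h; elim: n => //= n; apply: level_segment_map_le1.
exact: quadrant_iter.
Qed.

Lemma level_iter_ge1 n z : quadrant R z -> 1 <= s z -> 1 <= s (iter n T z).
Proof.
move=> hz h; elim: n => //= n; apply: level_segment_map_ge1.
exact: quadrant_iter.
Qed.

Lemma fixed_level1 e : s e = 1 -> T e = e.
Proof.
move=> h; rewrite segment_mapE h /growth !mulr1.
by rewrite !divff ?gt_eqF// !mul1r -surjective_pairing.
Qed.

Lemma level1_fixed e : quadrant R e -> 0 < s e -> T e = e -> s e = 1.
Proof.
move=> he h; rewrite segment_mapE => hT.
have [e1|n1] := eqVneq e.1 0; last first.
  apply: (growth_eq1 a0 (ltW h)); apply: (mulIf n1).
  by rewrite mul1r -{3}hT.
have [e2|n2] := eqVneq e.2 0; last first.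
  apply: (growth_eq1 d0 (ltW h)); apply: (mulIf n2).
  by rewrite mul1r -{3}hT.
by move: h; rewrite /level e1 e2 !mul0r addr0 ltxx.
Qed.

Lemma cvg_level (u : nat -> R * R) e :
  u @ \oo --> e -> s (u n) @[n --> \oo] --> s e.
Proof.
by move=> h; apply: cvgD; apply: cvgM; try exact: cvg_cst;
  [exact: cvg_pair_fst|exact: cvg_pair_snd].
Qed.

Lemma orbit_cvg z : quadrant R z -> 0 < s z ->
  exists e, [/\ iter n T z @[n --> \oo] --> e, quadrant R e & s e = 1].
Proof.
move=> hz h.
(* A limit is a fixed point, and a positive level excludes the origin. Below level 1 the limit
   dominates the starting point; above it, levels stay at least 1. *)
suff [e he hs] : exists2 e, iter n T z @[n --> \oo] --> e & 0 < s e.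
  have qe := cvg_iter_quadrant a1 d1 ad da hz he.
  by exists e; split=> //; apply: level1_fixed => //; exact: cvg_iter_fixed hz he.
have hn n : 0 <= (iter n T z).1 /\ 0 <= (iter n T z).2 := quadrant_iter n hz.
have sn n := level_iter_gt0 n hz h.
have Ta n : (iter n.+1 T z).1 = growth a (s (iter n T z)) * (iter n T z).1.
  by rewrite iterS segment_mapE.
have Td n : (iter n.+1 T z).2 = growth d (s (iter n T z)) * (iter n T z).2.
  by rewrite iterS segment_mapE.
have [h1|/ltW h1] := leP (s z) 1.
  have sn1 n := level_iter_le1 n hz h1.
  have [|n|e he [e1 e2]] := @nondecreasing_pair_cvg _ (fun n => iter n T z) a d.
  - move=> n; have [x0 y0] := hn n; rewrite Ta Td.
    by rewrite !ler_peMl// growth_ge1// sn1 ltW// sn.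
  - have [x0 y0] := hn n; have := sn1 n.
    have X0 : 0 <= (iter n T z).1 / a by rewrite divr_ge0// ltW.
    have Y0 : 0 <= (iter n T z).2 / d by rewrite divr_ge0// ltW.
    rewrite /level => hh; split.
      by rewrite -[X in _ <= X]mul1r -ler_pdivrMr//; lra.
    by rewrite -[X in _ <= X]mul1r -ler_pdivrMr//; lra.
  exists e => //; apply: (lt_le_trans h).
  by apply: lerD; rewrite ler_pM2r ?invr_gt0.
have sn1 n := level_iter_ge1 n hz h1.
have [||e he] := @nonincreasing_pair_cvg _ (fun n => iter n T z) 0 0.
- move=> n; have [x0 y0] := hn n; rewrite Ta Td.
  by rewrite !ler_piMl// growth_le1// sn1.
- exact: hn.
exists e => //; apply: (@lt_le_trans _ _ 1) => //.
by apply: (cvgr_to_ge (cvg_level he)); apply: nearW.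
Qed.

End SegmentMap.

Lemma limit_map_eq (R : realType) (T : R * R -> R * R) z e :
  iter n T z @[n --> \oo] --> e -> limit_map T z = e.
Proof.
move=> he; apply: (cvgn_pair_unique _ he).
by apply: xgetPex (ex_intro (fun e => iter n T z @[n --> \oo] --> e) e he).
Qed.

(** * The limit map: order, one-sided continuity, coordinate ratios *)

Section LimitMap.
Context {R : realType} {a d : R} (a0 : 0 < a) (d0 : 0 < d).
Implicit Types (e p q z : R * R) (n : nat).
Local Notation T := (segment_map a d).
Local Notation s := (level a d).
Local Notation L := (limit_map T).
Let a1 : 0 < 1 + a. Proof. exact: addr_gt0. Qed.
Let d1 : 0 < 1 + d. Proof. exact: addr_gt0. Qed.
Let ad : 0 < a / d. Proof. exact: divr_gt0. Qed.
Let da : 0 < d / a. Proof. exact: divr_gt0. Qed.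

Lemma limit_mapP z : quadrant R z -> 0 < s z ->
  [/\ iter n T z @[n --> \oo] --> L z, quadrant R (L z) & s (L z) = 1].
Proof.
by move=> hz h; have [e [he qe se]] := orbit_cvg a0 d0 hz h;
  rewrite (limit_map_eq he).
Qed.

Lemma limit_map_iter N z : quadrant R z -> 0 < s z -> L (iter N T z) = L z.
Proof.
move=> hz h; have [he _ _] := limit_mapP hz h; apply: limit_map_eq.
have -> : (fun n => iter n T (iter N T z)) = (fun n => iter (n + N) T z).
  by apply/funext => n; rewrite iterD.
exact: cvg_comp (cvg_addnr N) he.
Qed.

Lemma limit_map_level1 e : s e = 1 -> L e = e.
Proof.
move=> h; apply: limit_map_eq.
rewrite (_ : (fun n => _) = (fun=> e)); first exact: cvg_cst.
by apply/funext => n; elim: n => //= n ->; exact: fixed_level1.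
Qed.

Lemma limit_map_se p q : quadrant R p -> 0 < s p -> quadrant R q -> 0 < s q ->
  se_le p q -> se_le (L p) (L q).
Proof.
move=> hp sp hq sq pq; have [cp _ _] := limit_mapP hp sp.
have [cq _ _] := limit_mapP hq sq.
apply: (cvg_se_le cp cq) => n; exact: (iter_se a1 d1 ad da).
Qed.

Lemma limit_map_swap z : quadrant R z -> 0 < s z ->
  limit_map (segment_map d a) (z.2, z.1) = ((L z).2, (L z).1).
Proof.
move=> hz sz; have [cz _ _] := limit_mapP hz sz; apply: limit_map_eq.
rewrite (_ : (fun n => _) = (fun n => ((iter n T z).2, (iter n T z).1))).
  exact: (cvg_pair (cvg_pair_snd cz) (cvg_pair_fst cz)).
by apply/funext => n; rewrite segment_map_swap.
Qed.

Lemma quadrant_level1_le e : quadrant R e -> s e = 1 -> e.1 <= a.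
Proof.
move=> [x0 y0]; rewrite /level => h.
have Y0 : 0 <= e.2 / d by rewrite divr_ge0// ltW.
by rewrite -[X in _ <= X]mul1r -ler_pdivrMr//; lra.
Qed.

(* Near [z0], the point [T^N z] lies north-west of the equilibrium with first
   coordinate [(L z0).1 + eps], hence so does its limit. *)
Lemma limit_map_fst_usc z0 (eps : R) : quadrant R z0 -> 0 < s z0 -> 0 < eps ->
  \forall z \near z0, quadrant R z -> 0 < s z -> (L z).1 <= (L z0).1 + eps.
Proof.
move=> hz0 sz0 eps0; have [c0 [x0 y0] s0] := limit_mapP hz0 sz0.
(* No equilibrium of the segment lies beyond first coordinate [a], so a bound of at least [a] is
   automatic. *)
have [hlarge|hsmall] := leP a ((L z0).1 + eps).
  near=> z => hz sz; have [_ qz s1] := limit_mapP hz sz.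
  exact: le_trans (quadrant_level1_le qz s1) hlarge.
set x := (L z0).1 + eps in hsmall *.
set y := d * (1 - x / a).
have xp : 0 < x by rewrite ltr_wpDl.
have yp : 0 <= y by rewrite mulr_ge0 ?(ltW d0)// subr_ge0 ler_pdivrMr// mul1r ltW.
have sxy : s (x, y) = 1.
  by rewrite /level /y /=; field; rewrite !gt_eqF.
have yL : y < (L z0).2.
  have -> : (L z0).2 = d * (1 - (L z0).1 / a).
    by rewrite -s0 /level; field; rewrite !gt_eqF.
  by rewrite ltr_pM2l// ltrD2l ltrN2 ltr_pM2r ?invr_gt0// ltrDl.
have xL : (L z0).1 < x by rewrite ltrDl.
have [N _ /(_ N (leqnn N)) [hN1 hN2]] : \forall n \near \oo,
    (iter n T z0).1 < x /\ y < (iter n T z0).2.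
  near=> n; split; near: n.
    exact: (cvgr_lt _ (cvg_pair_fst c0)).
  exact: (cvgr_gt _ (cvg_pair_snd c0)).
have cN := iter_continuous (n := N) a1 d1 ad da hz0.
near=> z => hz sz.
have -> : L z = L (iter N T z) by rewrite limit_map_iter.
have -> : x = (L (x, y)).1 by rewrite limit_map_level1.
suff /limit_map_se[] : se_le (iter N T z) (x, y) => //.
- exact: quadrant_iter.
- exact: level_iter_gt0.
- by split => //=; exact: ltW.
- by rewrite sxy.
split => /=; apply: ltW; near: z.
  exact: (cvgr_lt _ (cvg_pair_fst cN)).
exact: (cvgr_gt _ (cvg_pair_snd cN)).
Unshelve. all: by end_near. Qed.

(** The lower level has the larger growth factor, so the ratio of the second coordinate of [T^n p]
    to that of [T^n q] never decreases; the cross-multiplied form also covers zero coordinates. *)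
Lemma limit_map_ratio_le p q : quadrant R p -> 0 < s p -> quadrant R q -> 0 < s q ->
  (forall n, s (iter n T p) <= s (iter n T q)) ->
  p.2 * (L q).2 <= q.2 * (L p).2.
Proof.
move=> hp sp hq sq hs; have [cp _ _] := limit_mapP hp sp.
have [cq _ _] := limit_mapP hq sq.
have c1 : p.2 * (iter n T q).2 @[n --> \oo] --> p.2 * (L q).2.
  by apply: cvgM; [exact: cvg_cst|exact: cvg_pair_snd].
have c2 : q.2 * (iter n T p).2 @[n --> \oo] --> q.2 * (L p).2.
  by apply: cvgM; [exact: cvg_cst|exact: cvg_pair_snd].
apply: (ler_cvg_to c1 c2); apply: nearW; elim => [|n IHn].
  by rewrite /= mulrC.
rewrite !iterS !segment_mapE//= mulrCA [X in _ <= X]mulrCA.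
have [_ yp] := quadrant_iter a0 d0 n hp.
have spn := level_iter_gt0 a0 d0 n hp sp.
apply: ler_pM => //.
- exact/ltW/growth_gt0/ltW/(level_iter_gt0 a0 d0 n hq sq).
- have [_ y0] := hp; have [_ yq] := quadrant_iter a0 d0 n hq.
  exact: mulr_ge0.
- by apply: growth_antitone => //; exact: ltW.
Qed.

(** This is [growth_sum_le] in the coordinates [z.1 / a] and [z.2 / d]; the sign hypothesis says
    that at the level of [q] the first coordinate grows at least as fast as the second. *)
Lemma level_step_le p q : quadrant R p -> quadrant R q -> se_le p q ->
  0 <= (a - d) * (1 - s q) -> s p <= s q -> s (T p) <= s (T q).
Proof.
move=> hp hq [pq1 pq2] hg hs; rewrite !level_segment_map//.
have [[x0 y0] [_ y0']] := (hp, hq).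
apply: growth_sum_le => //.
- by rewrite divr_ge0// ltW.
- by rewrite divr_ge0// ltW.
- by rewrite divr_ge0// ltW.
- by rewrite ler_pM2r ?invr_gt0.
- by rewrite ler_pM2r ?invr_gt0.
- by apply: growth_homo => //; exact: level_ge0.
Qed.

(** Once the level of [p] is at most that of [q], it remains so by [level_step_le]; if this never
    happens, the opposite order holds throughout. *)
Lemma levels_settle_of_sign p q : quadrant R p -> quadrant R q -> se_le p q ->
  (forall n, 0 <= (a - d) * (1 - s (iter n T q))) ->
  exists N,
    (forall n, s (iter n T (iter N T p)) <= s (iter n T (iter N T q))) \/
    (forall n, s (iter n T (iter N T q)) <= s (iter n T (iter N T p))).
Proof.
move=> hp hq pq hg.
have [[N hN]|hN] := pselect (exists N, s (iter N T p) <= s (iter N T q)).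
  exists N; left; elim => // n IHn; rewrite !iterS.
  apply: level_step_le => //.
  - by rewrite -iterD; exact: quadrant_iter.
  - by rewrite -iterD; exact: quadrant_iter.
  - by rewrite -!iterD; exact: (iter_se a1 d1 ad da).
  - by rewrite -iterD; exact: hg.
exists 0%N; right => n /=; apply/ltW; rewrite ltNge; apply/negP => h.
by apply: hN; exists n.
Qed.

(** An orbit starting on the vertical axis stays there, and so does its limit. *)
Lemma limit_map_fst_gt0 z : quadrant R z -> 0 < s z -> 0 < (L z).1 -> 0 < z.1.
Proof.
move=> hz sz; have [cz _ _] := limit_mapP hz sz.
have [+ _] := hz; rewrite le_eqVlt => /orP[/eqP z0|//].
suff -> : (L z).1 = 0 by rewrite ltxx.
apply: (cvg_unique (@Rhausdorff R) (cvg_pair_fst cz)).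
have -> : (fun n => (iter n T z).1) = (fun=> 0); last exact: cvg_cst.
apply/funext => n; elim: n => [|n IHn]; first by rewrite -z0.
by rewrite iterS segment_mapE// [LHS]/= IHn mulr0.
Qed.

Lemma iter_se_strict n p q : quadrant R p -> quadrant R q ->
  0 < p.1 -> 0 < q.2 -> se_le p q -> p <> q ->
  (iter n.+1 T p).1 < (iter n.+1 T q).1 /\
  (iter n.+1 T q).2 < (iter n.+1 T p).2.
Proof.
move=> hp hq p1 q2 pq ne.
suff /(_ n) [h1 h2 h3] : forall n, [/\ 0 < (iter n T p).1, 0 < (iter n T q).2
    & iter n T p <> iter n T q].
  apply: (lgmap_se_strict a1 d1 ad da) => //; try exact: quadrant_iter.
  exact: (iter_se a1 d1 ad da).
elim => [//|m [h1 h2 h3]].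
have [|lt1 lt2] := lgmap_se_strict a1 d1 ad da
  (quadrant_iter a0 d0 m hp) (quadrant_iter a0 d0 m hq) h1 h2 _ h3.
  exact: (iter_se a1 d1 ad da).
split.
- rewrite iterS segment_mapE//= mulr_gt0// growth_gt0// level_ge0//.
  exact: quadrant_iter.
- rewrite iterS segment_mapE//= mulr_gt0// growth_gt0// level_ge0//.
  exact: quadrant_iter.
- by move=> E; move: lt1; rewrite -!iterS E ltxx.
Qed.

End LimitMap.

(** * Injectivity on ordered pairs, and existence of fibre points *)

Section Fibres.
Context {R : realType} {a d : R} (a0 : 0 < a) (d0 : 0 < d).
Implicit Types (e p q z : R * R) (n : nat).
Local Notation T := (segment_map a d).
Local Notation s := (level a d).
Local Notation L := (limit_map T).

(** Levels never cross 1, so [(a - d) * (1 - s)] keeps its sign along each orbit. Orbits on the same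
    side of 1 fall under the previous criterion or its mirror image; otherwise 1 separates their
    levels forever. *)
Lemma levels_settle p q : quadrant R p -> quadrant R q -> se_le p q ->
  exists N,
    (forall n, s (iter n T (iter N T p)) <= s (iter n T (iter N T q))) \/
    (forall n, s (iter n T (iter N T q)) <= s (iter n T (iter N T p))).
Proof.
move=> hp hq pq.
set settled := (exists N, _).
have fromq : (forall n, 0 <= (a - d) * (1 - s (iter n T q))) -> settled.
  exact: levels_settle_of_sign.
(* Exchanging coordinates reverses the south-east order, so [p] takes the role of [q]. *)
have fromp : (forall n, 0 <= (d - a) * (1 - s (iter n T p))) -> settled.
  move=> h; have [||||N hN] := @levels_settle_of_sign _ _ _ d0 a0
    (q.2, q.1) (p.2, p.1).
  - by have [] := hq.
  - by have [] := hp.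
  - by have [] := pq.
  - by move=> n; rewrite segment_map_swap level_swap.
  exists N; rewrite !segment_map_swap in hN.
  case: hN => hN; [right|left] => n; have := hN n;
    by rewrite !segment_map_swap !level_swap.
have [p1|p1] := leP (s p) 1; have [q1|q1] := leP (s q) 1.
- have sp n := level_iter_le1 a0 d0 n hp p1.
  have sq n := level_iter_le1 a0 d0 n hq q1.
  have [ad|/ltW da] := leP d a.
    by apply: fromq => n; rewrite mulr_ge0// subr_ge0.
  by apply: fromp => n; rewrite mulr_ge0// subr_ge0.
- exists 0%N; left => n; apply: (@le_trans _ _ 1).
    exact: level_iter_le1.
  by apply: level_iter_ge1 => //; exact: ltW.
- exists 0%N; right => n; apply: (@le_trans _ _ 1).
    exact: level_iter_le1.
  by apply: level_iter_ge1 => //; exact: ltW.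
- have sp n := level_iter_ge1 a0 d0 n hp (ltW p1).
  have sq n := level_iter_ge1 a0 d0 n hq (ltW q1).
  have [ad|/ltW da] := leP a d.
    by apply: fromq => n; rewrite -mulrNN !opprB mulr_ge0// subr_ge0.
  by apply: fromp => n; rewrite -mulrNN !opprB mulr_ge0// subr_ge0.
Qed.

Lemma limit_map_snd_gt0 z : quadrant R z -> 0 < s z -> 0 < (L z).2 -> 0 < z.2.
Proof.
move=> hz sz; have := @limit_map_fst_gt0 _ _ _ d0 a0 (z.2, z.1).
by rewrite level_swap limit_map_swap// => /(_ _ sz) /=; apply; have [] := hz.
Qed.

Lemma limit_map_ratio_ge p q : quadrant R p -> 0 < s p -> quadrant R q -> 0 < s q ->
  (forall n, s (iter n T q) <= s (iter n T p)) ->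
  q.1 * (L p).1 <= p.1 * (L q).1.
Proof.
move=> hp sp hq sq h.
have := @limit_map_ratio_le _ _ _ d0 a0 (q.2, q.1) (p.2, p.1).
rewrite !level_swap !limit_map_swap//= => -> //.
- by have [] := hq.
- by have [] := hp.
- by move=> n; rewrite !segment_map_swap !level_swap.
Qed.

Lemma limit_map_se_inj p q : quadrant R p -> 0 < s p -> quadrant R q -> 0 < s q ->
  se_le p q -> L p = L q -> 0 < (L p).1 -> 0 < (L p).2 -> p = q.
Proof.
move=> hp sp hq sq pq E l1 l2; apply: contrapT => ne.
have p1 := limit_map_fst_gt0 a0 d0 hp sp l1.
have q2 : 0 < q.2 by apply: limit_map_snd_gt0; rewrite -?E.
(* Starting one step late gives the index [N.+1], at which both coordinates are already strictly
   ordered. *)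
have [|||N hN] := @levels_settle (T p) (T q).
- exact: (quadrant_iter a0 d0 1%N).
- exact: (quadrant_iter a0 d0 1%N).
- by apply: (iter_se _ _ _ _ 1%N) => //; rewrite ?addr_gt0// divr_gt0.
rewrite -!iterSr in hN.
have [lt1 lt2] := iter_se_strict a0 d0 N hp hq p1 q2 pq ne.
have hp' := quadrant_iter a0 d0 N.+1 hp; have hq' := quadrant_iter a0 d0 N.+1 hq.
have sp' := level_iter_gt0 a0 d0 N.+1 hp sp.
have sq' := level_iter_gt0 a0 d0 N.+1 hq sq.
case: hN => hN.
  have := limit_map_ratio_le a0 d0 hp' sp' hq' sq' hN.
  by rewrite !limit_map_iter// -E ler_pM2r// leNgt lt2.
have := limit_map_ratio_ge hp' sp' hq' sq' hN.
by rewrite !limit_map_iter// -E ler_pM2r// leNgt lt1.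
Qed.

Lemma limit_map_fstE z : quadrant R z -> 0 < s z ->
  (L z).1 = a * (1 - (L z).2 / d).
Proof.
move=> hz sz; have [_ _ <-] := limit_mapP a0 d0 hz sz.
by rewrite /level; field; rewrite !gt_eqF.
Qed.

(** The segment is decreasing, so the lower bound for the first coordinate is an upper bound for the
    second, obtained by exchanging coordinates; [d / a] rescales [eps] along the segment. *)
Lemma limit_map_fst_near z0 (eps : R) : quadrant R z0 -> 0 < s z0 -> 0 < eps ->
  \forall z \near z0, quadrant R z -> 0 < s z -> `|(L z0).1 - (L z).1| <= eps.
Proof.
move=> hz0 sz0 eps0.
have eps'0 : 0 < eps * d / a by rewrite divr_gt0// mulr_gt0.
have upper := limit_map_fst_usc a0 d0 hz0 sz0 eps0.
have hz0' : quadrant R (z0.2, z0.1) by have [] := hz0.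
have sz0' : 0 < level d a (z0.2, z0.1) by rewrite level_swap.
have cswap : (z.2, z.1) @[z --> z0] --> (z0.2, z0.1).
  exact: cvg_pair (continuous_snd (z := z0)) (continuous_fst (z := z0)).
have lower := cswap _ (limit_map_fst_usc d0 a0 hz0' sz0' eps'0).
near=> z => hz sz.
have up : (L z).1 <= (L z0).1 + eps.
  by move: hz sz; near: z; exact: upper.
have : (L z).2 <= (L z0).2 + eps * d / a.
  have : quadrant R (z.2, z.1) -> 0 < level d a (z.2, z.1) ->
    (limit_map (segment_map d a) (z.2, z.1)).1 <=
    (limit_map (segment_map d a) (z0.2, z0.1)).1 + eps * d / a.
    by near: z; exact: lower.
  by rewrite level_swap !limit_map_swap//=; apply => //; have [] := hz.
rewrite distrC ler_distl up andbT.
rewrite (limit_map_fstE hz sz) (limit_map_fstE hz0 sz0) => h.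
have -> : a * (1 - (L z0).2 / d) - eps =
          a * (1 - ((L z0).2 + eps * d / a) / d).
  by field; rewrite !gt_eqF.
by rewrite ler_pM2l// lerD2l lerN2 ler_pM2r ?invr_gt0.
Unshelve. all: by end_near. Qed.

(** The intermediate value theorem applies on the vertical line through [x]: the limit has first
    coordinate [a] at height 0 and at most [e.1 / 2] at height [M]. *)
Lemma fibre_exists e (x : R) : quadrant R e -> s e = 1 -> 0 < e.1 -> 0 < e.2 ->
  0 < x -> exists2 y, 0 < y & L (x, y) = e.
Proof.
move=> he se e1 e2 x0.
have qx y : 0 <= y -> quadrant R (x, y) by move=> y0; split => //=; exact: ltW.
have sx y : 0 <= y -> 0 < s (x, y).
  by move=> y0; apply: ltr_pwDl; [exact: divr_gt0|exact: divr_ge0 (ltW d0)].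
(* [M] is so large that [T (x, M)] lies north-west of the equilibrium [w] with
   first coordinate [e.1 / 2]: the summand [B] bounds the first coordinate of
   [T (x, M)], the summand [d + A] the second. *)
pose A := d * d / a * x; pose B := d / a * (2 * (1 + a) * x / e.1).
have A0 : 0 < A by rewrite mulr_gt0// divr_gt0// mulr_gt0.
have B0 : 0 < B by rewrite mulr_gt0 ?divr_gt0// ?mulr_gt0 ?addr_gt0.
pose M := d + A + B.
have M0 : 0 < M by rewrite !addr_gt0.
have e1a : e.1 < a.
  move: se; rewrite /level => se.
  have Y0 : 0 < e.2 / d by rewrite divr_gt0.
  by rewrite -[X in _ < X]mul1r -ltr_pdivrMr//; lra.
pose w : R * R := (e.1 / 2, d * (1 - e.1 / 2 / a)).
have sw : s w = 1 by rewrite /level /w /=; field; rewrite !gt_eqF.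
have qw : quadrant R w.
  split => /=; first by rewrite divr_ge0// ltW.
  rewrite mulr_ge0 ?(ltW d0)// subr_ge0 ler_pdivrMr// mul1r.
  by lra.
have LM : (L (x, M)).1 <= e.1 / 2.
  rewrite -(limit_map_iter a0 d0 1%N (qx _ (ltW M0)) (sx _ (ltW M0))).
  have -> : e.1 / 2 = (L w).1 by rewrite limit_map_level1.
  suff /(limit_map_se a0 d0)[] : se_le (iter 1 T (x, M)) w => //.
  - exact: (quadrant_iter a0 d0 1%N (qx _ (ltW M0))).
  - exact: (level_iter_gt0 a0 d0 1%N (qx _ (ltW M0)) (sx _ (ltW M0))).
  - by rewrite sw.
  split => /=.
    have hden : 0 < 1 + x + a / d * M.
      by rewrite !addr_gt0// mulr_gt0// divr_gt0.
    rewrite ler_pdivrMr//.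
    have : a / d * B <= 1 + x + a / d * M.
      rewrite -[X in X <= _]add0r lerD ?addr_ge0 ?ltW//.
      by rewrite ltr_pM2l ?divr_gt0// ltrDr addr_gt0.
    rewrite -(ler_pM2l (_ : 0 < e.1 / 2)) ?divr_gt0//; apply: le_trans.
    rewrite le_eqVlt; apply/orP; left; apply/eqP.
    by rewrite /B; field; rewrite !gt_eqF.
  have hden : 0 < 1 + M + d / a * x.
    by rewrite !addr_gt0// mulr_gt0// divr_gt0.
  (* The second coordinate of [w] is at most [d], and that of [T (x, M)] is at least [d] exactly
     when [d + A <= M]. *)
  apply: (@le_trans _ _ d).
    by rewrite -[X in _ <= X]mulr1 ler_pM2l// gerBl divr_ge0 ?divr_ge0 ?ltW.
  have -> : (1 + d) * M / (1 + M + d / a * x) = (1 + d) * M / (1 + M + A / d).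
    by congr (_ / (_ + _)); rewrite /A; field; rewrite !gt_eqF.
  rewrite ler_pdivlMr ?addr_gt0 ?divr_gt0//.
  rewrite mulrDr mulrCA divff ?gt_eqF// mulr1 /M.
  by lra.
have L0 : (L (x, 0)).1 = a.
  have [_ [_ L2] _] := limit_mapP a0 d0 (qx _ (lexx _)) (sx _ (lexx _)).
  have : ~ 0 < (L (x, 0)).2.
    move=> /(limit_map_snd_gt0 (qx _ (lexx _)) (sx _ (lexx _))).
    by rewrite /= ltxx.
  move=> /negP; rewrite -leNgt => L2'.
  rewrite limit_map_fstE; [|exact: qx|exact: sx].
  rewrite (_ : (L (x, 0)).2 = 0) ?mul0r ?subr0 ?mulr1//.
  by apply/eqP; rewrite eq_le L2'.
have [|||y] := @IVT R (fun y => (L (x, y)).1) 0 M e.1.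
- exact: ltW.
- apply/subspace_continuousP => y /=; rewrite in_itv /= => /andP[y0 yM].
  apply/cvgrPdist_le => eps eps0; rewrite near_withinE.
  have cx : (x, t) @[t --> y] --> (x, y).
    by apply: cvg_pairP; [exact: cvg_cst|exact: cvg_id].
  have nearx := cx _ (limit_map_fst_near (qx _ y0) (sx _ y0) eps0).
  near=> t; rewrite /= in_itv /= => /andP[t0 _].
  have := qx _ t0; have := sx _ t0 => /[swap]; near: t; exact: nearx.
- have LMa : (L (x, M)).1 <= a by lra.
  by rewrite L0 min_r// max_l//; lra.
rewrite in_itv /= => /andP[y0 yM] yE.
have Le : L (x, y) = e.
  have [_ _ s1] := limit_mapP a0 d0 (qx _ y0) (sx _ y0).
  move: (L (x, y)) e yE s1 se {he e1 e2 M w sw qw LM L0 yM A B A0 B0 M0 e1a}.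
  move=> [u v] [u' v'] /= ->.
  rewrite /level /= => <- /addrI /(mulIf _) -> //.
  by rewrite invr_eq0 gt_eqF.
exists y => //; apply: (@limit_map_snd_gt0 (x, y)); rewrite ?Le//.
  exact: qx.
exact: sx.
Unshelve. all: by end_near. Qed.

End Fibres.

(** * The stable set of an interior equilibrium as a curve *)

Section StableCurve.
Context {R : realType} {a d : R} (a0 : 0 < a) (d0 : 0 < d).
Local Notation T := (segment_map a d).
Local Notation s := (level a d).
Local Notation L := (limit_map T).
Context (e : R * R) (he : quadrant R e) (se : s e = 1).
Context (e1 : 0 < e.1) (e2 : 0 < e.2).
Implicit Types x y : R.

Let fibre x y := [/\ 0 < x, 0 < y & L (x, y) = e].

Let quadrant_gt0 x y : 0 < x -> 0 < y -> quadrant R (x, y).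
Proof. by move=> x0 y0; split; exact: ltW. Qed.

Let level_pair_gt0 x y : 0 < x -> 0 < y -> 0 < s (x, y).
Proof. by move=> x0 y0; rewrite addr_gt0 ?divr_gt0. Qed.

Let fibre_fst x : 0 < x -> exists y, fibre x y.
Proof.
by move=> x0; have [y y0 Le] := fibre_exists a0 d0 he se e1 e2 x0; exists y.
Qed.

Let fibre_snd y : 0 < y -> exists x, fibre x y.
Proof.
move=> y0; have [||||x x0 Le] := @fibre_exists _ _ _ d0 a0 (e.2, e.1) y _ _ _ _ y0.
- by have [] := he.
- by rewrite level_swap.
- by [].
- by [].
exists x; split => //; move: Le.
rewrite (@limit_map_swap _ _ _ a0 d0 (x, y)) //; last 2 first.
- exact: quadrant_gt0.
- exact: level_pair_gt0.
by move=> [E2 E1]; rewrite (surjective_pairing e) -E1 -E2 -surjective_pairing.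
Qed.

Let fibre_antisym x y x' y' : fibre x y -> fibre x' y' ->
  x <= x' -> y' <= y -> (x, y) = (x', y').
Proof.
move=> [x0 y0 E] [x'0 y'0 E'] xx' yy'.
apply: (limit_map_se_inj a0 d0); rewrite ?E ?E'//.
- exact: quadrant_gt0.
- exact: level_pair_gt0.
- exact: quadrant_gt0.
- exact: level_pair_gt0.
Qed.

Let fibre_lt x y x' y' : fibre x y -> fibre x' y' -> x < x' -> y < y'.
Proof.
move=> f f' xx'; rewrite ltNge; apply/negP => yy'.
by have [E _] := fibre_antisym f f' (ltW xx') yy'; rewrite E ltxx in xx'.
Qed.

Let fibre_lt_inv x y x' y' : fibre x y -> fibre x' y' -> y < y' -> x < x'.
Proof.
move=> f f' yy'; rewrite ltNge; apply/negP => xx'.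
by have [_ E] := fibre_antisym f' f xx' (ltW yy'); rewrite E ltxx in yy'.
Qed.

Lemma stable_setP z : stable_set T e z <-> fibre z.1 z.2.
Proof.
split=> [[hz cz]|[x0 y0 Le]]; last first.
  have qz : quadrant R z by split; exact: ltW.
  have sz : 0 < s z by case: z x0 y0 {Le qz} => x y; exact: level_pair_gt0.
  split => //; rewrite -Le -surjective_pairing.
  by have [] := limit_mapP a0 d0 qz sz.
have Le := limit_map_eq cz.
(* The origin is fixed, so its orbit cannot tend to [e]. *)
have sz : 0 < s z.
  apply: level_gt0 => // z0; move: e1; suff -> : e = (0, 0) by rewrite ltxx.
  apply: cvgn_pair_unique cz _; rewrite z0.
  have -> : (fun n => iter n T (0, 0)) = (fun=> (0, 0)); last exact: cvg_cst.
  by apply/funext; elim => //= n ->; rewrite segment_mapE//= !mulr0.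
split; last by rewrite -surjective_pairing.
  by apply: (limit_map_fst_gt0 a0 d0 hz sz); rewrite Le.
by apply: (limit_map_snd_gt0 a0 d0 hz sz); rewrite Le.
Qed.

Lemma stable_set_curve : unbounded_increasing_curve_from (0, 0) (stable_set T e).
Proof.
pose f x := xget 0 [set y | fibre x y].
have fP x : 0 < x -> fibre x (f x).
  by move=> /fibre_fst[y hy]; exact: xgetPex (ex_intro (fibre x) y hy).
(* The fibre meets height [y] at some [x' > x], and monotonicity keeps [f] below [y] to the left of
   [x']. The case [x = 0] gives the limit at the endpoint. *)
have f_lt x y : 0 < y -> 0 <= x -> (0 < x -> f x < y) ->
    \forall t \near x, 0 < t -> f t < y.
  move=> y0 x0 hxy; have [x' hx'] := fibre_snd y0.
  have xx' : x < x'.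
    move: x0; rewrite le_eqVlt => /orP[/eqP <-|x0]; first by case: hx'.
    exact: fibre_lt_inv (fP _ x0) hx' (hxy x0).
  near=> t => t0; apply: fibre_lt (fP _ t0) hx' _.
  by near: t; exact: lt_nbhsl.
exists [set x | 0 < x], f; split.
- split.
  + by move=> x y x0 _ t /andP[xt _]; exact: lt_le_trans xt.
  + move=> x y; rewrite !inE => x0 y0.
    exact: fibre_lt (fP _ x0) (fP _ y0).
  + apply/subspace_continuousP => x x0.
    apply: (iffRL (cvgrPdist_le _ _)) => eps eps0; rewrite near_withinE.
    have [_ fx0 _] := fP x x0.
    have up : \forall t \near x, 0 < t -> f t < f x + eps.
      by apply: f_lt; [exact: addr_gt0|exact: ltW|rewrite ltrDl].
    have low : \forall t \near x, 0 < t -> f x - eps < f t.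
      have [h|h] := leP (f x - eps) 0.
        by near=> t => t0; apply: le_lt_trans h _; have [] := fP t t0.
      have [x' hx'] := fibre_snd h.
      have xx' : x' < x.
        by apply: fibre_lt_inv hx' (fP _ x0) _; rewrite ltrBlDr ltrDl.
      near=> t => t0; apply: fibre_lt hx' (fP _ t0) _.
      by near: t; exact: lt_nbhsr.
    near=> t => /= t0; rewrite distrC ler_distl; apply/andP; split; apply: ltW.
      by move: t0; near: t; exact: low.
    by move: t0; near: t; exact: up.
  + apply/seteqP; split=> z; rewrite /= stable_setP.
      move=> hz; have [x0 y0 _] := hz; split => //.
      apply/eqP; rewrite eq_le !leNgt; apply/andP; split; apply/negP => h.
        by have := fibre_lt_inv (fP _ x0) hz h; rewrite ltxx.
      by have := fibre_lt_inv hz (fP _ x0) h; rewrite ltxx.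
    by move=> [x0 ->]; exact: fP.
- split => /=.
  + move=> B /nbhs_ballP[r /= r0 hB]; exists (r / 2); split => /=.
      exact: divr_gt0.
    apply: hB; rewrite /ball /= sub0r normrN gtr0_norm ?divr_gt0//.
    by rewrite ltr_pdivrMr// ltr_pMr// ltr1n.
  + by move=> x; exact: ltW.
  + apply: (iffRL (cvgrPdist_le _ _)) => eps eps0; rewrite near_withinE.
    have up : \forall t \near 0, 0 < t -> f t < eps.
      by apply: f_lt => //; rewrite ltxx.
    near=> t => /= t0; have [_ ft0 _] := fP t t0.
    rewrite sub0r normrN gtr0_norm//; apply: ltW.
    by move: t0; near: t; exact: up.
- move=> [M [_ hM]].
  (* The norm of a pair is the maximum, so this first coordinate alone exceeds the bound
     [|M| + 1]. *)
  pose x := `|M| + 2.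
  have x0 : 0 < x by rewrite ltr_wpDl.
  have hx : stable_set T e (x, f x) by apply/stable_setP; exact: fP.
  have MK : M < `|M| + 1 by rewrite (le_lt_trans (ler_norm M))// ltrDl.
  have /= := hM _ MK _ hx.
  rewrite prod_normE ge_max /= => /andP[+ _].
  by rewrite gtr0_norm// lerD2l leNgt ltr1n.
Unshelve. all: by end_near. Qed.

End StableCurve.

(** * Continuity of the limit map off the origin *)

Section Continuity.
Context {R : realType} {a d : R} (a0 : 0 < a) (d0 : 0 < d).

Lemma limit_map_continuous :
  {within quadrant R `\ (0, 0), continuous (limit_map (segment_map a d))}.
Proof.
apply/subspace_continuousP => z0 [hz0 /= nz0].
have sz0 := level_gt0 a0 d0 hz0 nz0.
apply: cvg_pairP.
  apply: (iffRL (cvgrPdist_le _ _)) => eps eps0; rewrite near_withinE.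
  near=> z => -[hz nz]; have := level_gt0 a0 d0 hz nz; move: hz.
  near: z; exact: limit_map_fst_near.
apply: (iffRL (cvgrPdist_le _ _)) => eps eps0; rewrite near_withinE.
(* Limits lie on the line of level 1, where a change [eps] of the second coordinate matches
   [a * eps / d] of the first. *)
have eps'0 : 0 < a * eps / d by rewrite divr_gt0// mulr_gt0.
near=> z => -[hz nz]; have sz := level_gt0 a0 d0 hz nz.
have : `|(limit_map (segment_map a d) z0).1 - (limit_map (segment_map a d) z).1|
    <= a * eps / d.
  by move: hz sz; near: z; exact: limit_map_fst_near.
rewrite !limit_map_fstE// -mulrBr opprD addrACA subrr add0r opprK addrC -mulrBl.
rewrite normrM (gtr0_norm a0) normrM normfV (gtr0_norm d0) -mulrA.
by rewrite ler_pM2l// ler_pM2r ?invr_gt0// distrC.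
Unshelve. all: by end_near. Qed.

End Continuity.

(** * The degenerate case [b1 = b2 = 1] *)

Lemma lgmap11_cvg0 (R : realType) (c1 c2 : R) z : 0 < c1 -> 0 < c2 ->
  quadrant R z -> iter n (lgmap 1 1 c1 c2) z @[n --> \oo] --> (0, 0).
Proof.
move=> hc1 hc2 hz.
have hn n : quadrant R (iter n (lgmap 1 1 c1 c2) z) by exact: iter_quadrant.
have [||e ce] := @nonincreasing_pair_cvg _ (fun n => iter n (lgmap 1 1 c1 c2) z) 0 0.
- move=> n; have [x0 y0] := hn n; rewrite iterS.
  move: (iter n _ z) x0 y0 => [x y] /= x0 y0; split.
    rewrite ler_pdivrMr ?denominator_gt0// mul1r ler_peMr// -addrA lerDl.
    by rewrite addr_ge0// mulr_ge0// ltW.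
  rewrite ler_pdivrMr ?denominator_gt0// mul1r ler_peMr// -addrA lerDl.
  by rewrite addr_ge0// mulr_ge0// ltW.
- exact: hn.
suff -> : (0, 0) = e by [].
have he : quadrant R e by exact: cvg_iter_quadrant ce.
have Te : lgmap 1 1 c1 c2 e = e by exact: cvg_iter_fixed ce.
(* The fixed-point equation becomes [x ^ 2 + c * x * y = 0], a sum of non-negative terms. *)
have zero (c x y : R) : 0 < c -> 0 <= x -> 0 <= y ->
    1 * x / (1 + x + c * y) = x -> x = 0.
  move=> c0 x0 y0 /(congr1 ( *%R^~ (1 + x + c * y))).
  rewrite divfK ?gt_eqF ?denominator_gt0// => E.
  have cy : 0 <= c * y by rewrite mulr_ge0// ltW.
  by apply/eqP; rewrite -sqrf_eq0 eq_le sqr_ge0 andbT; nra.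
move: he Te; case: e {ce} => x y [/= x0 y0] [/zero -> // /zero -> //].
Qed.

Lemma solution_iter (R : realType) (T : R * R -> R * R) u :
  solution T u -> u = fun n => iter n T (u 0%N).
Proof. by move=> [_ hu]; apply/funext; elim => //= n <-. Qed.

(** The hypothesis [hE] places the segment in the quadrant. The origin is left out of the continuity
    claim: it is fixed, while for [1 < b1] all other orbits tend to the segment, away from it. *)
Theorem theorem11 (R : realType) (b1 b2 c1 c2 : R)
    (hb1 : 0 < b1) (hb2 : 0 < b2) (hc1 : 0 < c1) (hc2 : 0 < c2)
    (h1 : c1 * (b2 - 1) = b1 - 1) (h2 : c2 * (b1 - 1) = b2 - 1)
    (hE : 1 <= b1) :
  [/\ (forall u : nat -> R * R,
         solution (lgmap b1 b2 c1 c2) u -> u <> (fun=> (0, 0)) ->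
         exists e : R * R,
           [/\ segmentE b1 b2 e, equilibrium (lgmap b1 b2 c1 c2) e
             & u n @[n --> \oo] --> e]),
      (forall e : R * R, segmentE b1 b2 e -> e.1 <> 0 -> e.2 <> 0 ->
         unbounded_increasing_curve_from (0, 0)
           (stable_set (lgmap b1 b2 c1 c2) e))
    & {within quadrant R `\ (0, 0),
         continuous (limit_map (lgmap b1 b2 c1 c2))}].
Proof.
move: hE; rewrite le_eqVlt => /orP[/eqP b11|b1gt1].
  have b21 : b2 = 1 by apply/eqP; rewrite -subr_eq0 -h2 -b11 subrr mulr0.
  rewrite -b11 b21; split.
  - move=> u hu _; exists (0, 0); split.
    + by exists 0; rewrite lexx ler01 !subrr !mul0r.
    + by split; [split|rewrite /lgmap /= !mulr0 !mul0r].
    + rewrite (solution_iter hu); apply: lgmap11_cvg0 => //.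
      by have [] := hu.
  (* The segment is reduced to the origin, so no equilibrium qualifies. *)
  - by move=> e [t [_ ->]] /=; rewrite subrr mul0r.
  - apply/subspace_continuousP => z [hz _].
    have zero := limit_map_eq (lgmap11_cvg0 hc1 hc2 _).
    apply: cvg_near_cst; rewrite near_withinE; near=> z' => -[hz' _].
    exact: etrans (zero _ hz') (esym (zero _ hz)).
have a0 : 0 < b1 - 1 by rewrite subr_gt0.
have d0 : 0 < b2 - 1 by rewrite -h2 mulr_gt0.
have -> : lgmap b1 b2 c1 c2 = segment_map (b1 - 1) (b2 - 1).
  rewrite /segment_map.
  have <- : c1 = (b1 - 1) / (b2 - 1) by rewrite -h1 mulfK ?gt_eqF.
  have <- : c2 = (b2 - 1) / (b1 - 1) by rewrite -h2 mulfK ?gt_eqF.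
  by rewrite ![1 + _]addrC !subrK.
split.
- move=> u hu nu.
  have hz : quadrant R (u 0%N) by have [] := hu.
  have nz : u 0%N <> (0, 0).
    move=> u0; apply: nu; rewrite (solution_iter hu) u0.
    apply/funext; elim => //= n ->.
    by rewrite segment_mapE//= !mulr0.
  have [e [ce [x0 y0] se]] := orbit_cvg a0 d0 hz (level_gt0 a0 d0 hz nz).
  exists e; split; last by rewrite (solution_iter hu).
    have X0 : 0 <= e.1 / (b1 - 1) by rewrite divr_ge0// ltW.
    have Y0 : 0 <= e.2 / (b2 - 1) by rewrite divr_ge0// ltW.
    move: se; rewrite /level => se.
    (* Level 1 means that [e.1 / (b1 - 1)] and [e.2 / (b2 - 1)] sum to 1; they are [1 - t] and
       [t]. *)
    exists (e.2 / (b2 - 1)); split; first by apply/andP; split; lra.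
    rewrite [LHS]surjective_pairing; congr pair.
      have -> : 1 - e.2 / (b2 - 1) = e.1 / (b1 - 1) by lra.
      by rewrite mulrC divfK ?gt_eqF.
    by rewrite mulrC divfK ?gt_eqF.
  by split => //; exact: fixed_level1.
- move=> e [t [/andP[t0 t1] ->]] /= /eqP n1 /eqP n2.
  have t1' : 0 <= 1 - t by rewrite subr_ge0.
  apply: stable_set_curve => //.
  + by split; [exact: mulr_ge0 (ltW a0) t1'|exact: mulr_ge0 (ltW d0) t0].
  + by rewrite /level /=; field; rewrite !gt_eqF.
  + by rewrite lt_neqAle eq_sym n1; exact: mulr_ge0 (ltW a0) t1'.
  + by rewrite lt_neqAle eq_sym n2; exact: mulr_ge0 (ltW d0) t0.
- exact: limit_map_continuous.
Unshelve. all: by end_near. Qed.
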